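(* Let $\mathscr{D}$ be a $\Bbbk$-linear triangulated category for a field $\Bbbk$. Let $\tau=(\mathscr{D}^{\le 0},\mathscr{D}^{\ge 0})$ be a noetherian t-structure on $\mathscr{D}$. Let $E_1,\dots,E_n\in\mathscr{D}^{\heartsuit}$ be an exceptional sequence of objects in the heart of $\tau$ such that $$\mathrm{Hom}(E_i,E_j)=0\quad\text{for all } i<j.$$ Let $\mathscr{D}=\langle E_1,E_2,\dots,E_n,\mathscr{C}\rangle$ be the corresponding semiorthogonal decomposition of $\mathscr{D}$. Then $\tau$ connectively induces a t-structure $\tau_{\mathscr{C}}^{-}$ on $\mathscr{C}$, which is bounded if $\tau$ is bounded.
   Context: For objects $D,D'$ write $\mathrm{RHom}(D,D')=\bigoplus_{n}\mathrm{Hom}(D,D'[n])[-n]$. An object $D\in\mathscr{D}$ is homologically finite-dimensional if $\mathrm{RHom}(D,D')$ and $\mathrm{RHom}(D',D)$ have finite total dimension over $\Bbbk$ for all $D'\in\mathscr{D}$. An object $E$ is exceptional if it is homologically finite-dimensional and $\Bbbk\to\mathrm{RHom}(E,E)$ (classifying $\mathrm{id}_E$) is an isomorphism. A sequence $E_1,\dots,E_n$ of exceptional objects is an exceptional sequence if $\mathrm{RHom}(E_i,E_j)=0$ for $i>j$. Convention: in a semiorthogonal decomposition $\langle \mathscr{D}_1,\dots,\mathscr{D}_m\rangle$ one has $\mathrm{RHom}(\mathscr{D}_i,\mathscr{D}_j)=0$ for $i>j$. An exceptional sequence gives a semiorthogonal decomposition $\mathscr{D}=\langle E_1,\dots,E_n,\mathscr{C}\rangle$,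 where $E_i$ stands for the triangulated subcategory it generates and $\mathscr{C}=\{D\in\mathscr{D}:\mathrm{RHom}(D,E_i)=0 \text{ for all } i\}$. For a t-structure put $\mathscr{D}^{\le n}=\mathscr{D}^{\le 0}[-n]$, $\mathscr{D}^{\ge n}=\mathscr{D}^{\ge 0}[-n]$, heart $\mathscr{D}^{\heartsuit}=\mathscr{D}^{\le 0}\cap\mathscr{D}^{\ge 0}$. It is noetherian if its heart is a noetherian abelian category (ascending chains of subobjects of any object stabilize), and bounded if every object lies in some $\mathscr{D}^{\ge a}\cap\mathscr{D}^{\le b}$. $\tau$ connectively induces a t-structure on the full triangulated subcategory $\mathscr{C}$ if the pair $\tau_{\mathscr{C}}^{-}=(\mathscr{C}^{\le 0},\mathscr{C}^{\ge 0})$ with $\mathscr{C}^{\le 0}=\mathscr{D}^{\le 0}\cap\mathscr{C}$ and $\mathscr{C}^{\ge 0}=\{C\in\mathscr{C}:\mathrm{Hom}(C'[1],C)=0\text{ for all }C'\in\mathscr{C}^{\le 0}\}$ is a t-structure on $\mathscr{C}$. *)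

(* Defs.v *)
From mathcomp Require Import all_boot all_order all_algebra.
Set Implicit Arguments.
Unset Strict Implicit.
Unset Printing Implicit Defensive.
Import GRing.Theory.
Local Open Scope ring_scope.

Record lin_cat (k : fieldType) := LinCat {
  ob :> Type;
  mor : ob -> ob -> lmodType k;
  idm : forall X, mor X X;
  cmp : forall X Y Z, mor Y Z -> mor X Y -> mor X Z;
  cmp1m : forall X Y (f : mor X Y), cmp (idm Y) f = f;
  cmpm1 : forall X Y (f : mor X Y), cmp f (idm X) = f;
  cmpA : forall X Y Z W (h : mor Z W) (g : mor Y Z) (f : mor X Y),
    cmp h (cmp g f) = cmp (cmp h g) f;
  cmp_linear_r : forall X Y Z (g : mor Y Z), linear (@cmp X Y Z g);
  cmp_linear_l : forall X Y Z (f : mor X Y), linear (fun g : mor Y Z => cmp g f);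
  lin_cat_zero : exists Z : ob, idm Z = 0;
  lin_cat_biprod : forall X Y : ob, exists (S : ob)
    (i : mor X S) (j : mor Y S) (p : mor S X) (q : mor S Y),
    [/\ cmp p i = idm X, cmp q j = idm Y, cmp q i = 0, cmp p j = 0
      & cmp i p + cmp j q = idm S]
}.
Arguments mor {k l} X Y.
Arguments idm {k l} X.
Arguments cmp {k l X Y Z} g f.

Declare Scope cat_scope.
Delimit Scope cat_scope with cat.
Notation "g \c f" := (cmp g f) (at level 40, left associativity) : cat_scope.
Open Scope cat_scope.

Definition is_iso (k : fieldType) (C : lin_cat k) (X Y : C) (f : mor X Y) : Prop :=
  exists g : mor Y X, g \c f = idm X /\ f \c g = idm Y.

Definition isomorphic (k : fieldType) (C : lin_cat k) (X Y : C) : Prop :=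
  exists f : mor X Y, is_iso f.

Definition iso_closed (k : fieldType) (C : lin_cat k) (P : C -> Prop) : Prop :=
  forall X Y : C, isomorphic X Y -> P X -> P Y.

Record lin_functor (k : fieldType) (C D : lin_cat k) := LinFunctor {
  fob :> C -> D;
  fmap : forall X Y : C, mor X Y -> mor (fob X) (fob Y);
  fmap1 : forall X : C, fmap (idm X) = idm (fob X);
  fmapM : forall (X Y Z : C) (g : mor Y Z) (f : mor X Y),
    fmap (g \c f) = fmap g \c fmap f;
  fmap_linear : forall X Y : C, linear (@fmap X Y)
}.
Arguments fmap {k C D} l {X Y} f.

(** The shift functor [Sh] is an autoequivalence, with chosen quasi-inverse
  [Shi]; it is not required to be a strict automorphism.  A triangle on
  [f : X -> Y], [g : Y -> Z], [h : Z -> Sh X] is distinguished when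
  [dist f g h]. *)

Record tri_cat (k : fieldType) := TriCat {
  tcat :> lin_cat k;
  Sh : lin_functor tcat tcat;
  Shi : lin_functor tcat tcat;
  sh_unit : forall X : tcat, mor X (Shi (Sh X));
  sh_unit_iso : forall X, is_iso (sh_unit X);
  sh_unit_nat : forall (X Y : tcat) (f : mor X Y),
    sh_unit Y \c f = fmap Shi (fmap Sh f) \c sh_unit X;
  sh_counit : forall X : tcat, mor (Sh (Shi X)) X;
  sh_counit_iso : forall X, is_iso (sh_counit X);
  sh_counit_nat : forall (X Y : tcat) (f : mor X Y),
    f \c sh_counit X = sh_counit Y \c fmap Sh (fmap Shi f);
  dist : forall X Y Z : tcat, mor X Y -> mor Y Z -> mor Z (Sh X) -> Prop;
  (* Verdier's axioms TR1-TR4; TR1 *)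
  dist_iso : forall (X Y Z X' Y' Z' : tcat)
    (f : mor X Y) (g : mor Y Z) (h : mor Z (Sh X))
    (f' : mor X' Y') (g' : mor Y' Z') (h' : mor Z' (Sh X'))
    (a : mor X X') (b : mor Y Y') (c : mor Z Z'),
    is_iso a -> is_iso b -> is_iso c ->
    b \c f = f' \c a -> c \c g = g' \c b -> fmap Sh a \c h = h' \c c ->
    dist f g h -> dist f' g' h';
  dist_id : forall X Z : tcat, idm Z = 0 ->
    dist (idm X) (0 : mor X Z) (0 : mor Z (Sh X));
  dist_cone : forall (X Y : tcat) (f : mor X Y),
    exists (Z : tcat) (g : mor Y Z) (h : mor Z (Sh X)), dist f g h;
  (* TR2 *)
  dist_rot : forall (X Y Z : tcat)
    (f : mor X Y) (g : mor Y Z) (h : mor Z (Sh X)),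
    dist f g h <-> dist g h (- fmap Sh f);
  (* TR3 *)
  dist_mor : forall (X Y Z X' Y' Z' : tcat)
    (f : mor X Y) (g : mor Y Z) (h : mor Z (Sh X))
    (f' : mor X' Y') (g' : mor Y' Z') (h' : mor Z' (Sh X'))
    (a : mor X X') (b : mor Y Y'),
    dist f g h -> dist f' g' h' -> b \c f = f' \c a ->
    exists c : mor Z Z', c \c g = g' \c b /\ fmap Sh a \c h = h' \c c;
  (* TR4 *)
  dist_oct : forall (X Y Z X' Y' Z' : tcat) (f : mor X Y) (g : mor Y Z)
    (u : mor Y Z') (u' : mor Z' (Sh X))
    (v : mor Z Y') (v' : mor Y' (Sh X))
    (w : mor Z X') (w' : mor X' (Sh Y)),
    dist f u u' -> dist (g \c f) v v' -> dist g w w' ->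
    exists (p : mor Z' Y') (q : mor Y' X'),
      dist p q (fmap Sh u \c w') /\
      [/\ p \c u = v \c g, v' \c p = u', q \c v = w & w' \c q = fmap Sh f \c v']
}.
Arguments Sh {k t}.
Arguments Shi {k t}.
Arguments dist {k t X Y Z} f g h.

(** [sh n X] is X[n]. *)
Definition sh (k : fieldType) (D : tri_cat k) (n : int) (X : D) : D :=
  match n with
  | Posz m => iter m Sh X
  | Negz m => iter m.+1 Shi X
  end.

Section RHom.
Variables (k : fieldType) (D : tri_cat k).
Implicit Types X Y : D.

Definition rhom_family X Y := forall n : int, mor X (sh n Y).

(** Membership in the direct sum of the Hom(X, Y[n]). *)
Definition fin_supp X Y (f : rhom_family X Y) : Prop :=
  exists s : seq int, forall n : int, n \notin s -> f n = 0.

(** The direct sum of the Hom(X, Y[n]) is spanned by finitely many elements. *)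
Definition rhom_findim X Y : Prop :=
  exists (d : nat) (v : 'I_d -> rhom_family X Y),
    (forall i, fin_supp (v i)) /\
    (forall f : rhom_family X Y, fin_supp f ->
      exists c : 'I_d -> k, forall n : int, f n = \sum_(i < d) c i *: v i n).

Definition rhom_zero X Y : Prop := forall (n : int) (f : mor X (sh n Y)), f = 0.

Definition homologically_findim X : Prop :=
  forall Y, rhom_findim X Y /\ rhom_findim Y X.

Definition exceptional X : Prop :=
  [/\ homologically_findim X,
      bijective (fun c : k => c *: idm X : mor X (sh 0 X))
    & forall n : int, n != 0 -> forall f : mor X (sh n X), f = 0].

Definition exceptional_seq (n : nat) (E : 'I_n -> D) : Prop :=
  (forall i, exceptional (E i)) /\
  (forall i j : 'I_n, (j < i)%N -> rhom_zero (E i) (E j)).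

End RHom.

Record tri_sub (k : fieldType) (D : tri_cat k) := TriSub {
  tmem :> D -> Prop;
  tmem_iso : iso_closed tmem;
  tmem_zero : forall Z : D, idm Z = 0 -> tmem Z;
  tmem_biprod : forall (X Y S : D)
    (i : mor X S) (j : mor Y S) (p : mor S X) (q : mor S Y),
    [/\ p \c i = idm X, q \c j = idm Y, q \c i = 0, p \c j = 0
      & i \c p + j \c q = idm S] ->
    tmem X -> tmem Y -> tmem S;
  tmem_Sh : forall X : D, tmem X -> tmem (Sh X);
  tmem_Shi : forall X : D, tmem X -> tmem (Shi X);
  tmem_cone : forall (X Y Z : D) (f : mor X Y) (g : mor Y Z) (h : mor Z (Sh X)),
    dist f g h -> tmem X -> tmem Y -> tmem Z
}.

Section SubCat.
Variables (k : fieldType) (D : tri_cat k) (C : tri_sub D).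

Let sob := {X : D | C X}.
Let shom (X Y : sob) : lmodType k := mor (sval X) (sval Y).

Definition sub_lin_cat : lin_cat k.
Proof.
refine (@LinCat k sob shom (fun X => idm (sval X))
  (fun X Y Z (g : shom Y Z) (f : shom X Y) => g \c f) _ _ _ _ _ _ _).
- by move=> X Y f; apply: cmp1m.
- by move=> X Y f; apply: cmpm1.
- by move=> *; apply: cmpA.
- by move=> X Y Z g; apply: cmp_linear_r.
- by move=> X Y Z f; apply: cmp_linear_l.
- have [Z Z0] := lin_cat_zero D.
  by exists (exist _ Z (tmem_zero C Z0)).
- move=> [X CX] [Y CY]; have [S [i [j [p [q B]]]]] := lin_cat_biprod X Y.
  by exists (exist _ S (tmem_biprod B CX CY)), i, j, p, q.
Defined.

Definition sub_Sh : lin_functor sub_lin_cat sub_lin_cat.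
Proof.
refine (@LinFunctor k sub_lin_cat sub_lin_cat
  (fun X : sob => exist _ (Sh (sval X)) (tmem_Sh (svalP X)))
  (fun X Y (f : shom X Y) => fmap Sh f) _ _ _).
- by move=> X; apply: fmap1.
- by move=> *; apply: fmapM.
- by move=> X Y; apply: (@fmap_linear k D D Sh (sval X) (sval Y)).
Defined.

Definition sub_Shi : lin_functor sub_lin_cat sub_lin_cat.
Proof.
refine (@LinFunctor k sub_lin_cat sub_lin_cat
  (fun X : sob => exist _ (Shi (sval X)) (tmem_Shi (svalP X)))
  (fun X Y (f : shom X Y) => fmap Shi f) _ _ _).
- by move=> X; apply: fmap1.
- by move=> *; apply: fmapM.
- by move=> X Y; apply: (@fmap_linear k D D Shi (sval X) (sval Y)).
Defined.

Definition sub_tri_cat : tri_cat k.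
Proof.
refine (@TriCat k sub_lin_cat sub_Sh sub_Shi
  (fun X : sob => sh_unit (sval X)) _ _
  (fun X : sob => sh_counit (sval X)) _ _
  (fun (X Y Z : sob) (f : shom X Y) (g : shom Y Z)
       (h : mor (sval Z) (Sh (sval X))) => dist f g h) _ _ _ _ _ _).
- by move=> X; apply: sh_unit_iso.
- by move=> X Y f; apply: sh_unit_nat.
- by move=> X; apply: sh_counit_iso.
- by move=> X Y f; apply: sh_counit_nat.
- move=> X Y Z X' Y' Z' f g h f' g' h' a b c ia ib ic.
  exact: (@dist_iso k D _ _ _ _ _ _ f g h f' g' h' a b c ia ib ic).
- by move=> X Z; apply: dist_id.
- move=> [X CX] [Y CY] f; have [Z [g [h fgh]]] := dist_cone f.
  by exists (exist _ Z (tmem_cone fgh CX CY)), g, h.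
- by move=> X Y Z f g h; apply: dist_rot.
- move=> X Y Z X' Y' Z' f g h f' g' h' a b.
  exact: (@dist_mor k D _ _ _ _ _ _ f g h f' g' h' a b).
- move=> X Y Z X' Y' Z' f g u u' v v' w w'.
  exact: (@dist_oct k D _ _ _ _ _ _ f g u u' v v' w w').
Defined.

End SubCat.
Coercion sub_tri_cat : tri_sub >-> tri_cat.

Record t_pair (k : fieldType) (D : tri_cat k) := TPair {
  le0 : D -> Prop;
  ge0 : D -> Prop
}.

Section TStructure.
Variables (k : fieldType) (D : tri_cat k) (t : t_pair D).

Definition le_n (n : int) (X : D) : Prop :=
  exists2 Y : D, le0 t Y & isomorphic X (sh (- n) Y).

Definition ge_n (n : int) (X : D) : Prop :=
  exists2 Y : D, ge0 t Y & isomorphic X (sh (- n) Y).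

Definition is_tstructure : Prop :=
  [/\ iso_closed (le0 t) /\ iso_closed (ge0 t),
      forall X : D, le0 t X -> le_n 1 X,
      forall X : D, ge_n 1 X -> ge0 t X,
      forall X Y : D, le0 t X -> ge_n 1 Y -> forall f : mor X Y, f = 0
    & forall X : D, exists (A B : D) (f : mor A X) (g : mor X B) (h : mor B (Sh A)),
        [/\ le0 t A, ge_n 1 B & dist f g h]].

Definition heart (X : D) : Prop := le0 t X /\ ge0 t X.

Definition heart_mono (A X : D) (m : mor A X) : Prop :=
  forall Z : D, heart Z -> forall f g : mor Z A, m \c f = m \c g -> f = g.

(** Subobjects of [X] are represented by monomorphisms [m i : A i -> X] of the
  heart, ordered by factorization. *)
Definition noetherian : Prop :=
  forall X : D, heart X ->
  forall (A : nat -> D) (m : forall i, mor (A i) X),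
    (forall i, heart (A i)) -> (forall i, heart_mono (m i)) ->
    (forall i, exists u : mor (A i) (A i.+1), m i.+1 \c u = m i) ->
    exists N : nat, forall i, (N <= i)%N ->
      exists u : mor (A i) (A N), m N \c u = m i.

Definition bounded : Prop :=
  forall X : D, exists a b : int, ge_n a X /\ le_n b X.

End TStructure.

Definition conn_pair (k : fieldType) (D : tri_cat k) (t : t_pair D) (C : tri_sub D)
    : t_pair C :=
  let le0C (X : C) := le0 t (sval X) in
  {| le0 := le0C;
     ge0 := fun X : C => forall X' : C, le0C X' -> forall f : mor (sh 1 X') X, f = 0 |}.

Definition connectively_induces (k : fieldType) (D : tri_cat k) (t : t_pair D)
    (C : tri_sub D) : Prop :=
  is_tstructure (conn_pair t C).

Section LinFacts.
Variables (k : fieldType) (C : lin_cat k).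
Implicit Types X Y Z : C.

Lemma linear_map0 (U V : lmodType k) (f : U -> V) : linear f -> f 0 = 0.
Proof.
move=> lf; have := lf (-1) 0 0.
by rewrite scaler0 addr0 scaleN1r addNr.
Qed.

Lemma cmpm0 X Y Z (g : mor Y Z) : g \c (0 : mor X Y) = 0.
Proof. exact: (linear_map0 (cmp_linear_r g)). Qed.

Lemma cmp0m X Y Z (f : mor X Y) : (0 : mor Y Z) \c f = 0.
Proof. exact: (linear_map0 (cmp_linear_l f)). Qed.

Lemma cmpDm X Y Z (g g' : mor Y Z) (f : mor X Y) :
  (g + g') \c f = g \c f + g' \c f.
Proof. by have := cmp_linear_l f 1 g g'; rewrite !scale1r. Qed.

Lemma cmpmD X Y Z (g : mor Y Z) (f f' : mor X Y) :
  g \c (f + f') = g \c f + g \c f'.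
Proof. by have := cmp_linear_r g 1 f f'; rewrite !scale1r. Qed.

Lemma fmap0 (D : lin_cat k) (F : lin_functor C D) X Y : fmap F (0 : mor X Y) = 0.
Proof. exact: (linear_map0 (@fmap_linear _ _ _ F X Y)). Qed.

Lemma is_iso1 X : is_iso (idm X).
Proof. by exists (idm X); rewrite cmp1m. Qed.

Lemma isomorphic_refl X : isomorphic X X.
Proof. by exists (idm X); apply: is_iso1. Qed.

Lemma isomorphic_sym X Y : isomorphic X Y -> isomorphic Y X.
Proof. by move=> [f [g [gf fg]]]; exists g, f. Qed.

Lemma zero_obj_to Z X (f : mor X Z) : idm Z = 0 -> f = 0.
Proof. by move=> Z0; rewrite -(cmp1m f) Z0 cmp0m. Qed.

Lemma hom_zero_iso X X' Y Y' : isomorphic X X' -> isomorphic Y Y' ->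
  (forall f : mor X Y, f = 0) -> forall f : mor X' Y', f = 0.
Proof.
move=> [a [a' [_ aa']]] [b [b' [_ bb']]] XY0 f.
rewrite -(cmp1m f) -bb' -(cmpm1 f) -aa'.
by rewrite !cmpA -!cmpA (cmpA f) (cmpA b') (XY0 (b' \c (f \c a))) ?cmp0m ?cmpm0.
Qed.

End LinFacts.

Section LeftOrthogonal.
Variables (k : fieldType) (D : tri_cat k).
Implicit Types X Y Z W : D.

Lemma shS n X : isomorphic (sh (n + 1) X) (Sh (sh n X)).
Proof.
case: n => [m|[|m]].
- by rewrite -PoszD addn1; apply: isomorphic_refl.
- by apply: isomorphic_sym; exists (sh_counit X); apply: sh_counit_iso.
- have -> : Negz m.+1 + 1 = Negz m by rewrite !NegzE -addn1 PoszD opprD addrNK.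
  apply: isomorphic_sym; exists (sh_counit (sh (Negz m) X)); exact: sh_counit_iso.
Qed.

Lemma shP n X : isomorphic (sh (n - 1) X) (Shi (sh n X)).
Proof.
case: n => [[|m]|m].
- exact: isomorphic_refl.
- have -> : Posz m.+1 - 1 = Posz m by rewrite -addn1 PoszD addrK.
  by exists (sh_unit (sh (Posz m) X)); apply: sh_unit_iso.
- have -> : Negz m - 1 = Negz m.+1 by rewrite !NegzE -[in RHS]addn1 PoszD opprD.
  exact: isomorphic_refl.
Qed.

Lemma Sh_faithful0 X Y (f : mor X Y) : fmap Sh f = 0 -> f = 0.
Proof.
move=> f0; have [r [ru _]] := sh_unit_iso Y.
by rewrite -(cmp1m f) -ru -cmpA sh_unit_nat f0 fmap0 cmp0m cmpm0.
Qed.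

Lemma Shi_faithful0 X Y (f : mor X Y) : fmap Shi f = 0 -> f = 0.
Proof.
move=> f0; have [r [_ ur]] := sh_counit_iso X.
by rewrite -(cmpm1 f) -ur cmpA sh_counit_nat f0 fmap0 cmpm0 cmp0m.
Qed.

Lemma idm_Sh0 Z : idm Z = 0 -> idm (Sh Z) = 0.
Proof. by move=> Z0; rewrite -fmap1 Z0 fmap0. Qed.

Lemma dist_factor X Y Z W (f : mor X Y) (g : mor Y Z) (h : mor Z (Sh X))
  (e : mor Z W) : dist f g h -> e \c g = 0 -> exists e' : mor (Sh X) W, e = e' \c h.
Proof.
move=> fgh eg0; have [O O0] := lin_cat_zero D.
have dW : dist (0 : mor O W) (idm W) (0 : mor W (Sh O)).
  apply/dist_rot; rewrite fmap0 oppr0; exact/dist_id/idm_Sh0.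
have [|c [ch _]] := dist_mor (a := 0 : mor Y O) (b := e) ((dist_rot _ _ _).1 fgh) dW.
  by rewrite eg0 cmp0m.
by exists c; rewrite ch cmp1m.
Qed.

Variables (I : Type) (E : I -> D).

Definition left_orth_mem X : Prop := forall i, rhom_zero X (E i).

Definition left_orth : tri_sub D.
Proof.
refine (@TriSub k D left_orth_mem _ _ _ _ _ _).
- move=> X Y XY CX i n; apply: (hom_zero_iso XY (isomorphic_refl _)); exact: CX.
- by move=> Z Z0 i n f; rewrite -(cmpm1 f) Z0 cmpm0.
- move=> X Y S i j p q [_ _ _ _ S1] CX CY a n f.
  rewrite -(cmpm1 f) -S1 cmpmD !cmpA.
  by rewrite (CX a n (f \c i)) (CY a n (f \c j)) !cmp0m addr0.
- move=> X CX i n f; apply: Shi_faithful0.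
  apply: (hom_zero_iso _ (shP n (E i)) (CX i (n - 1))).
  by exists (sh_unit X); apply: sh_unit_iso.
- move=> X CX i n f; apply: Sh_faithful0.
  apply: (hom_zero_iso _ (shS n (E i)) (CX i (n + 1))).
  by apply: isomorphic_sym; exists (sh_counit X); apply: sh_counit_iso.
- move=> X Y Z f g h fgh CX CY i n e.
  have [e' ->] := dist_factor fgh (CY i n (e \c g)).
  suff -> : e' = 0 by rewrite cmp0m.
  apply: Shi_faithful0.
  apply: (hom_zero_iso _ (shP n (E i)) (CX i (n - 1))).
  by exists (sh_unit X); apply: sh_unit_iso.
Defined.

End LeftOrthogonal.

(* Main.v *)
Require Import Defs.
From mathcomp Require Import all_boot all_order all_algebra.
From Stdlib Require Import ClassicalEpsilon.

Set Implicit Arguments.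
Unset Strict Implicit.
Unset Printing Implicit Defensive.
Import GRing.Theory.
Local Open Scope ring_scope.

(** Write C for the left orthogonal of the E_i.  What has to be constructed is a
  coreflection of each X of C into the part of C of degree at most 0: the cone B of
  the coreflection then lies in C and receives no map from that part.  It is the
  composite of three maps
<<
    C0 -> B0 -> A0 -> X
>>
  in the ambient category, none of whose cones receives a nonzero map from an
  object of C of degree at most 0; this property is [colocal], and it is stable
  under composition by the octahedral axiom.

  The first step is the truncation of X in degrees at most 0.  Its value A0 need not
  lie in C, and because of its maps to the E_i projecting it to C could create
  cohomology in degree 1.  The second step ([tilt_coreflection]) removes these
  maps.  The objects of the heart without maps to any E_i form a torsion class;
  the heart being noetherian, every object H has a largest torsion subobject, and
  B0 is its preimage in A0 for H the degree-0 cohomology of A0.  The abelian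
  structure of the heart is never developed: images and preimages are fibers of
  truncations of cones, and subobjects are enlarged until the noetherian
  condition forbids it ([exists_torsion_radical]).

  The third step ([tors_coreflection]) projects B0 to C.  A nonzero map from B0 to
  E_m[i+1], with i >= 0, is killed by passing to its fiber, an extension of B0 by
  E_m[i]; this keeps the degree at most 0 and lowers the finite total dimension of
  RHom(-, E_m) by one ([kill_rhom]).  The hypothesis Hom(E_i, E_j) = 0 for i < j
  ensures that extending by E_m creates no maps to the other E_j, so that
  only shifts E_j[i+1] with i >= 0 ever have to be treated, while the order of the
  exceptional sequence ensures that the E_j already treated stay orthogonal.

  For boundedness, X[b] of degree at most 0 has that degree in C, and X[a] of degree
  at least 0 receives no maps from any object of degree at most -1, in particular
  from none in C. *)

(** * Hom-vanishing and the shift functor *)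

Section LinearCategory.
Variables (k : fieldType) (D : lin_cat k).
Implicit Types X Y Z : D.

Lemma cmpNm X Y Z (g : mor Y Z) (f : mor X Y) : (- g) \c f = - (g \c f).
Proof. by apply/eqP; rewrite -addr_eq0 -cmpDm addNr cmp0m. Qed.

Lemma cmpmN X Y Z (g : mor Y Z) (f : mor X Y) : g \c (- f) = - (g \c f).
Proof. by apply/eqP; rewrite -addr_eq0 -cmpmD addNr cmpm0. Qed.

Lemma cmpBm X Y Z (g g' : mor Y Z) (f : mor X Y) :
  (g - g') \c f = g \c f - g' \c f.
Proof. by rewrite cmpDm cmpNm. Qed.

Lemma cmpmB X Y Z (g : mor Y Z) (f f' : mor X Y) :
  g \c (f - f') = g \c f - g \c f'.
Proof. by rewrite cmpmD cmpmN. Qed.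

Lemma cmpZm X Y Z a (g : mor Y Z) (f : mor X Y) : (a *: g) \c f = a *: (g \c f).
Proof. by have := cmp_linear_l f a g 0; rewrite cmp0m !addr0. Qed.

Lemma cmp_suml X Y Z d (F : 'I_d -> mor Y Z) (f : mor X Y) :
  (\sum_(i < d) F i) \c f = \sum_(i < d) F i \c f.
Proof.
apply: (big_morph (fun g : mor Y Z => g \c f)) => [g g'|].
  exact: cmpDm.
exact: cmp0m.
Qed.

Lemma fmapZ (D' : lin_cat k) (F : lin_functor D D') X Y a (f : mor X Y) :
  fmap F (a *: f) = a *: fmap F f.
Proof. by have := @fmap_linear _ _ _ F X Y a f 0; rewrite fmap0 !addr0. Qed.

Lemma fmapN (D' : lin_cat k) (F : lin_functor D D') X Y (f : mor X Y) :
  fmap F (- f) = - fmap F f.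
Proof. by rewrite -scaleN1r fmapZ scaleN1r. Qed.

Lemma fmapB (D' : lin_cat k) (F : lin_functor D D') X Y (f g : mor X Y) :
  fmap F (f - g) = fmap F f - fmap F g.
Proof. by have := @fmap_linear _ _ _ F X Y 1 f (- g); rewrite !scale1r fmapN. Qed.

Lemma is_iso_opp X Y (f : mor X Y) : is_iso f -> is_iso (- f).
Proof. by move=> [g [gf fg]]; exists (- g); rewrite !cmpmN !cmpNm !opprK. Qed.

Lemma isomorphic_trans X Y Z : isomorphic X Y -> isomorphic Y Z -> isomorphic X Z.
Proof.
move=> [f [f' [ff' f'f]]] [g [g' [gg' g'g]]]; exists (g \c f), (f' \c g').
by rewrite -!cmpA (cmpA g') gg' cmp1m ff' (cmpA f) f'f cmp1m g'g.
Qed.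

Lemma isomorphic_fmap (D' : lin_cat k) (F : lin_functor D D') X Y :
  isomorphic X Y -> isomorphic (F X) (F Y).
Proof.
move=> [f [g [gf fg]]]; exists (fmap F f), (fmap F g).
by rewrite -!fmapM gf fg !fmap1.
Qed.

Definition hom0 X Y := forall f : mor X Y, f = 0.

Lemma hom0_iso X X' Y Y' :
  isomorphic X X' -> isomorphic Y Y' -> hom0 X Y -> hom0 X' Y'.
Proof. exact: hom_zero_iso. Qed.

Lemma hom0_isor X Y Y' : isomorphic Y Y' -> hom0 X Y -> hom0 X Y'.
Proof. by move=> YY'; apply/hom0_iso => //; apply: isomorphic_refl. Qed.

Lemma hom0_zerol X Y : idm X = 0 -> hom0 X Y.
Proof. by move=> X0 f; rewrite -(cmpm1 f) X0 cmpm0. Qed.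

Lemma hom0_zeror X Y : idm Y = 0 -> hom0 X Y.
Proof. by move=> Y0 f; apply: zero_obj_to. Qed.

End LinearCategory.

Section Triangulated.
Variables (k : fieldType) (D : tri_cat k).
Implicit Types X Y Z W : D.

Lemma isomorphic_ShShi X : isomorphic (Sh (Shi X)) X.
Proof. by exists (sh_counit X); apply: sh_counit_iso. Qed.

Lemma isomorphic_ShiSh X : isomorphic (Shi (Sh X)) X.
Proof. by apply: isomorphic_sym; exists (sh_unit X); apply: sh_unit_iso. Qed.

(** Conjugating [fmap Shi g] by the unit gives a preimage [f]: naturality makes
  [fmap Shi (fmap Sh f)] and [fmap Shi g] agree, and [Shi] is faithful. *)
Lemma Sh_full X Y (g : mor (Sh X) (Sh Y)) : exists f : mor X Y, fmap Sh f = g.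
Proof.
have [r [ru ur]] := sh_unit_iso Y; have [s [su us]] := sh_unit_iso X.
exists (r \c fmap Shi g \c sh_unit X).
set f := _ \c sh_unit X.
apply/eqP; rewrite -subr_eq0; apply/eqP/Shi_faithful0.
rewrite fmapB; apply/eqP; rewrite subr_eq0; apply/eqP.
have := sh_unit_nat f => /(congr1 (fun h => h \c s)).
rewrite -!cmpA us !cmpm1 => <-.
by rewrite cmpA ur cmp1m.
Qed.

Lemma Sh_inj X Y (f g : mor X Y) : fmap Sh f = fmap Sh g -> f = g.
Proof.
move=> fg; apply/eqP; rewrite -subr_eq0; apply/eqP/Sh_faithful0.
by rewrite fmapB fg subrr.
Qed.

Lemma hom0_Sh X Y : hom0 X Y <-> hom0 (Sh X) (Sh Y).
Proof.
split=> XY0 f; last exact/Sh_faithful0/XY0.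
by have [g <-] := Sh_full f; rewrite (XY0 g) fmap0.
Qed.

Lemma hom0_ShShi X Y : hom0 (Sh X) Y <-> hom0 X (Shi Y).
Proof.
rewrite (hom0_Sh X); split; apply: hom0_isor; last exact: isomorphic_ShShi.
exact/isomorphic_sym/isomorphic_ShShi.
Qed.

Lemma isomorphic_sh X Y m : isomorphic X Y -> isomorphic (sh m X) (sh m Y).
Proof.
by case: m => i XY; elim: i => [|i IH] //=; apply: isomorphic_fmap.
Qed.

Lemma isomorphic_sh_sh X m l : isomorphic (sh m (sh l X)) (sh (m + l) X).
Proof.
case: m => i.
  elim: i => [|i IH]; first by rewrite add0r; apply: isomorphic_refl.
  rewrite -addn1 PoszD addrAC.
  apply: isomorphic_trans (isomorphic_sym (shS _ X)).
  apply: isomorphic_trans (shS _ _) _.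
  exact: isomorphic_fmap.
elim: i => [|i IH].
  by rewrite addrC; apply/isomorphic_sym/shP.
rewrite -[Negz i.+1]/(- i.+2%:Z) -addn1 PoszD opprD addrAC.
apply: isomorphic_trans (isomorphic_sym (shP _ X)).
apply: isomorphic_trans (shP _ _) _.
exact: isomorphic_fmap.
Qed.

Lemma isomorphic_shK X m : isomorphic (sh (- m) (sh m X)) X.
Proof. by have := isomorphic_sh_sh X (- m) m; rewrite addNr. Qed.

Lemma isomorphic_shNK X m : isomorphic (sh m (sh (- m) X)) X.
Proof. by have := isomorphic_sh_sh X m (- m); rewrite subrr. Qed.

(** * Exactness of Hom and construction of triangles *)

Lemma dist_id_src X Z : idm Z = 0 -> dist (0 : mor Z X) (idm X) (0 : mor X (Sh Z)).
Proof. by move=> Z0; apply/dist_rot; rewrite fmap0 oppr0; apply/dist_id/idm_Sh0. Qed.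

Lemma dist_cmp0 X Y Z (f : mor X Y) (g : mor Y Z) (h : mor Z (Sh X)) :
  dist f g h -> g \c f = 0.
Proof.
move=> fgh; have [O O0] := lin_cat_zero D.
have [|c [c1 _]] := dist_mor (a := idm X) (b := f) (dist_id X O0) fgh.
  by [].
by rewrite -c1 cmpm0.
Qed.

Lemma dist_extend X Y Z W (f : mor X Y) (g : mor Y Z) (h : mor Z (Sh X))
  (e : mor Y W) : dist f g h -> e \c f = 0 -> exists e' : mor Z W, e = e' \c g.
Proof.
move=> fgh ef0; have [O O0] := lin_cat_zero D.
have [|c [cg _]] := dist_mor (a := 0 : mor X O) (b := e) fgh (dist_id_src W O0).
  by rewrite ef0 cmp0m.
by exists c; rewrite cg cmp1m.
Qed.

Lemma dist_lift X Y Z W (f : mor X Y) (g : mor Y Z) (h : mor Z (Sh X))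
  (e : mor W Y) : dist f g h -> g \c e = 0 -> exists e' : mor W X, e = f \c e'.
Proof.
move=> fgh ge0; have [O O0] := lin_cat_zero D.
have dW := (dist_rot _ _ _).1 (dist_id W O0).
have [|c [_ ce]] := dist_mor (a := e) (b := 0 : mor O Z) dW ((dist_rot _ _ _).1 fgh).
  by rewrite ge0 cmp0m.
have [e' e'c] := Sh_full c; exists e'; apply: Sh_inj.
move: ce; rewrite fmap1 cmpmN cmpm1 cmpNm -e'c -fmapM.
by move/(congr1 -%R); rewrite !opprK.
Qed.

Lemma hom0_mid_src X Y Z W (f : mor X Y) (g : mor Y Z) (h : mor Z (Sh X)) :
  dist f g h -> hom0 X W -> hom0 Z W -> hom0 Y W.
Proof.
move=> fgh XW ZW e; have [e' ->] := dist_extend fgh (XW (e \c f)).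
by rewrite (ZW e') cmp0m.
Qed.

Lemma hom0_mid_tgt X Y Z W (f : mor X Y) (g : mor Y Z) (h : mor Z (Sh X)) :
  dist f g h -> hom0 W X -> hom0 W Z -> hom0 W Y.
Proof.
move=> fgh WX WZ e; have [e' ->] := dist_lift fgh (WZ (g \c e)).
by rewrite (WX e') cmpm0.
Qed.

Lemma hom0_fib_tgt X Y Z W (f : mor X Y) (g : mor Y Z) (h : mor Z (Sh X)) :
  dist f g h -> hom0 (Sh W) Z -> hom0 W Y -> hom0 W X.
Proof.
move=> /dist_rot/dist_rot fgh WZ WY; apply/hom0_Sh.
by apply: (hom0_mid_tgt fgh) => //; exact: (hom0_Sh _ _).1 WY.
Qed.

(** Three rotations negate all three maps; two of the signs cancel along [-1] on the
  middle object. *)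
Lemma dist_Sh X Y Z (f : mor X Y) (g : mor Y Z) (h : mor Z (Sh X)) :
  dist f g h <-> dist (fmap Sh f) (fmap Sh g) (- fmap Sh h).
Proof.
have -> : dist f g h <-> dist (- fmap Sh f) (- fmap Sh g) (- fmap Sh h).
  by rewrite -!dist_rot.
split; apply: (dist_iso (a := idm _) (b := - idm _) (c := idm _));
  rewrite ?fmap1 ?cmpNm ?cmpmN ?cmp1m ?cmpm1 ?opprK //; try exact: is_iso1;
  exact/is_iso_opp/is_iso1.
Qed.

(** The middle object is the cone of [f] shifted back, its maps being unshifted by
  fullness of [Sh]. *)
Lemma exists_mid X Z (f : mor Z (Sh X)) :
  exists (Y : D) (w : mor X Y) (a : mor Y Z), dist w a f.
Proof.
have [V [g [h fgh]]] := dist_cone f.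
have [r [re er]] := sh_counit_iso V.
have [a a_h] := Sh_full (- (h \c sh_counit V)).
have [w w_g] := Sh_full (- (r \c g)).
exists (Shi V), w, a; do 2!apply/dist_rot.
rewrite a_h w_g !opprK; apply: dist_iso fgh; [exact: is_iso1|exact: is_iso1| | | | ].
- by exists (sh_counit V); split; [exact: er|exact: re].
- by rewrite cmp1m cmpm1.
- by rewrite cmpm1.
- by rewrite fmap1 cmp1m -cmpA er cmpm1.
Qed.

Lemma exists_fiber Y Z (g : mor Y Z) :
  exists (X : D) (f : mor X Y) (h : mor Z (Sh X)), dist f g h.
Proof.
have [V [p [q gpq]]] := dist_cone g.
have [r [re er]] := sh_counit_iso V.
have [f f_q] := Sh_full (- (q \c sh_counit V)).
exists (Shi V), f, (r \c p); apply/dist_rot; rewrite f_q opprK.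
apply: dist_iso gpq; [exact: is_iso1|exact: is_iso1| | | | ].
- by exists (sh_counit V); split; [exact: er|exact: re].
- by rewrite cmp1m cmpm1.
- by rewrite cmpm1.
- by rewrite fmap1 cmp1m -cmpA er cmpm1.
Qed.

(** The octahedral axiom for the fibers [L], [T], [A] of [f], [g] and [g \c f];
  their shifts are the cones that the axiom speaks of. *)
Lemma dist_oct_fiber X Y Z L T A (f : mor X Y) (g : mor Y Z)
  (l : mor L X) (l' : mor Y (Sh L)) (t : mor T Y) (t' : mor Z (Sh T))
  (a : mor A X) (a' : mor Z (Sh A)) :
  dist l f l' -> dist t g t' -> dist a (g \c f) a' ->
  exists (p : mor L A) (q : mor A T) (r : mor T (Sh L)),
    [/\ dist p q r, a \c p = l & t \c q = f \c a].
Proof.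
move=> /dist_rot dl /dist_rot dt /dist_rot da.
have [p [q [pq [_ ap _ tq]]]] := dist_oct dl da dt.
have [p1 p1p] := Sh_full p; have [q1 q1q] := Sh_full q.
exists p1, q1, (l' \c t); split.
- apply/dist_Sh; rewrite p1p q1q fmapM -cmpmN; exact: pq.
- apply: Sh_inj; rewrite fmapM p1p; apply: oppr_inj; rewrite -cmpNm; exact: ap.
- by apply: Sh_inj; apply: oppr_inj; rewrite !fmapM q1q -cmpNm -cmpmN.
Qed.

End Triangulated.

(** * Maps whose cone is right orthogonal to a class *)

Section Colocal.
Variables (k : fieldType) (D : tri_cat k).
Implicit Types X Y Z W : D.

Lemma dist_cone0_iso X Y Z (f : mor X Y) (g : mor Y Z) (h : mor Z (Sh X)) :
  dist f g h -> idm Z = 0 -> is_iso f.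
Proof.
move=> fgh Z0; have [|s fs] := dist_lift (e := idm Y) fgh; first exact: hom0_zeror.
exists s; split=> //; apply/eqP; rewrite -subr_eq0; apply/eqP/Sh_faithful0.
have fu : - fmap Sh f \c fmap Sh (s \c f - idm X) = 0.
  by rewrite cmpNm -fmapM cmpmB cmpA -fs cmp1m cmpm1 subrr fmap0 oppr0.
have [e ->] := dist_lift ((dist_rot _ _ _).1 ((dist_rot _ _ _).1 fgh)) fu.
by rewrite (hom0_zeror Z0 e) cmpm0.
Qed.

(** When [A] itself satisfies [Q] and [Q] is stable under the shift, this says
  that [f] exhibits [A] as the coreflection of [X] into [Q]. *)
Definition colocal (Q : D -> Prop) A X (f : mor A X) : Prop :=
  exists (Z : D) (g : mor X Z) (h : mor Z (Sh A)),
    dist f g h /\ forall S, Q S -> hom0 S Z.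

Lemma colocal_id (Q : D -> Prop) X : colocal Q (idm X).
Proof.
have [O O0] := lin_cat_zero D.
by exists O, 0, 0; split=> [|S _]; [apply: dist_id | apply: hom0_zeror].
Qed.

Lemma colocal_sub (Q R : D -> Prop) A X (f : mor A X) :
  (forall S, R S -> Q S) -> colocal Q f -> colocal R f.
Proof. by move=> RQ [Z [g [h [fgh QZ]]]]; exists Z, g, h; split=> // S /RQ/QZ. Qed.

(** By the octahedral axiom the cone of a composite is an extension of the two
  cones. *)
Lemma colocal_comp (Q : D -> Prop) A X Y (f : mor A X) (g : mor X Y) :
  colocal Q f -> colocal Q g -> colocal Q (g \c f).
Proof.
move=> [U [u [u' [du QU]]]] [V [v [v' [dv QV]]]].
have [W [w [w' dw]]] := dist_cone (g \c f).
exists W, w, w'; split=> // S QS.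
have [p [q [pq _]]] := dist_oct du dw dv.
by apply: (hom0_mid_tgt pq); [apply: QU | apply: QV].
Qed.

End Colocal.

(** * Orthogonality in a t-structure *)

Section TStructureTheory.
Variables (k : fieldType) (D : tri_cat k) (tau : t_pair D).
Hypothesis tau_t : is_tstructure tau.
Implicit Types X Y Z W : D.

Lemma le0_Sh X : le0 tau X -> le0 tau (Sh X).
Proof.
have [[le_iso _] le_le1 _ _ _] := tau_t.
move=> /le_le1 [Y Y0 XY]; apply: le_iso Y0; apply: isomorphic_sym.
exact: isomorphic_trans (isomorphic_fmap Sh XY) (isomorphic_ShShi _).
Qed.

Lemma le0_iter_Sh i X : le0 tau X -> le0 tau (iter i Sh X).
Proof. by move=> X0; elim: i => //= i; apply: le0_Sh. Qed.

Lemma le0P X : le0 tau X <-> forall Y, ge_n tau 1 Y -> hom0 X Y.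
Proof.
have [[le_iso _] _ _ orth trunc] := tau_t.
split=> [X0 Y Y1|X0]; first exact: orth.
have [A [B [f [g [h [A0 B1 fgh]]]]]] := trunc X.
have [|e be] := dist_factor (e := idm B) fgh.
  by rewrite cmp1m (X0 B B1 g).
apply: (le_iso A) (A0); exists f; apply: dist_cone0_iso fgh _.
by rewrite be (orth _ _ (le0_Sh A0) B1 e) cmp0m.
Qed.

Lemma gt0P Y : ge_n tau 1 Y <-> forall X, le0 tau X -> hom0 X Y.
Proof.
have [[le_iso _] _ _ orth trunc] := tau_t.
split=> [Y1 X X0|Y1]; first exact: orth.
have [A [B [f [g [h [A0 [C C0 BC] fgh]]]]]] := trunc Y.
exists C => //; apply: isomorphic_trans (BC); exists g.
have dg := (dist_rot _ _ _).1 fgh; apply: dist_cone0_iso (dg) _.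
have [|e se] := dist_lift (e := idm (Sh A)) ((dist_rot _ _ _).1 dg).
  by rewrite (Y1 A A0 f) fmap0 oppr0 cmp0m.
suff e0 : e = 0 by rewrite se e0 cmpm0.
by apply: (orth _ _ (le0_Sh A0)); exists C.
Qed.

Lemma ge0P X : ge0 tau X <-> forall Y, le0 tau Y -> hom0 (Sh Y) X.
Proof.
have [[_ ge_iso] _ _ orth _] := tau_t.
split=> [X0 Y Y0|X0].
  apply/hom0_ShShi; apply: orth => //; exists X => //; exact: isomorphic_refl.
have /gt0P [Y Y0 XY] : forall Y, le0 tau Y -> hom0 Y (Shi X).
  by move=> Y Y0; apply/hom0_ShShi/X0.
apply: ge_iso Y0; apply: isomorphic_sym.
apply: isomorphic_trans (isomorphic_sym (isomorphic_ShShi X)) _.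
exact: isomorphic_trans (isomorphic_fmap Sh XY) (isomorphic_ShShi Y).
Qed.

Lemma ge0_iter_Shi i X : ge0 tau X -> ge0 tau (iter i Shi X).
Proof.
have [_ _ gt_ge _ _] := tau_t.
move=> X0; elim: i => //= i Xi; apply: gt_ge.
by exists (iter i Shi X) => //; apply: isomorphic_refl.
Qed.

Lemma le0_ext X Y Z (f : mor X Y) (g : mor Y Z) (h : mor Z (Sh X)) :
  dist f g h -> le0 tau X -> le0 tau Z -> le0 tau Y.
Proof.
by move=> fgh /le0P X0 /le0P Z0; apply/le0P => W W1; apply: (hom0_mid_src fgh); auto.
Qed.

Lemma le0_cone X Y Z (f : mor X Y) (g : mor Y Z) (h : mor Z (Sh X)) :
  dist f g h -> le0 tau X -> le0 tau Y -> le0 tau Z.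
Proof. by move=> /dist_rot fgh /le0_Sh X0 Y0; apply: le0_ext fgh _ _. Qed.

Lemma ge0_fiber X Y Z (f : mor X Y) (g : mor Y Z) (h : mor Z (Sh X)) :
  dist f g h -> ge0 tau Y -> ge0 tau Z -> ge0 tau X.
Proof.
move=> fgh /ge0P Y0 /ge0P Z0; apply/ge0P => W W0.
apply: (hom0_fib_tgt fgh); last exact: Y0.
exact/Z0/le0_Sh.
Qed.

(** The truncation axiom cuts between degrees 0 and 1; applied to [Shi K] and
  shifted back it cuts [K] between degrees -1 and 0. *)
Lemma trunc_ge0 (K : D) : exists (L G : D) (l : mor (Sh L) K) (g : mor K G)
  (h : mor G (Sh (Sh L))), [/\ le0 tau L, ge0 tau G & dist l g h].
Proof.
have [[_ ge_iso] _ _ _ trunc] := tau_t.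
have [A [B [f [g [h [A0 [C C0 BC] /dist_Sh fgh]]]]]] := trunc (Shi K).
have [r [re er]] := sh_counit_iso K.
exists A, (Sh B), (sh_counit K \c fmap Sh f), (fmap Sh g \c r), (- fmap Sh h); split=> //.
  apply: ge_iso C0; apply: isomorphic_sym.
  exact: isomorphic_trans (isomorphic_fmap Sh BC) (isomorphic_ShShi C).
apply: dist_iso fgh; [exact: is_iso1|exact: sh_counit_iso|exact: is_iso1| | | ].
- by rewrite cmpm1.
- by rewrite cmp1m -cmpA re cmpm1.
- by rewrite fmap1 cmp1m cmpm1.
Qed.

(** * The torsion class cogenerated by objects of nonnegative degree *)

Variables (I : Type) (E : I -> D).
Hypothesis E_ge0 : forall i, ge0 tau (E i).

Definition tors S : Prop := le0 tau S /\ forall i, hom0 S (E i).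

Lemma tors_ext X Y Z (f : mor X Y) (g : mor Y Z) (h : mor Z (Sh X)) :
  dist f g h -> tors X -> tors Z -> tors Y.
Proof.
move=> fgh [X0 XE] [Z0 ZE]; split; first exact: le0_ext fgh X0 Z0.
by move=> i; apply: (hom0_mid_src fgh).
Qed.

Lemma tors_Sh L : le0 tau L -> tors (Sh L).
Proof.
by move=> L0; split=> [|i]; [apply: le0_Sh | have /ge0P := E_ge0 i; apply].
Qed.

Record tors_subobject (H : D) := TorsSubobject {
  tsub : D;
  tquo : D;
  tin : mor tsub H;
  tpr : mor H tquo;
  tconn : mor tquo (Sh tsub);
  ts_dist : dist tin tpr tconn;
  ts_sub : heart tau tsub;
  ts_quo : heart tau tquo;
  ts_tors : tors tsub
}.

Lemma tin_mono H (q : tors_subobject H) : heart_mono tau (tin q).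
Proof.
move=> Z [Z0 _] f g mfg; apply/eqP; rewrite -subr_eq0; apply/eqP/Sh_faithful0.
have fg : - fmap Sh (tin q) \c fmap Sh (f - g) = 0.
  by rewrite cmpNm -fmapM cmpmB mfg subrr fmap0 oppr0.
have [e ->] := dist_lift ((dist_rot _ _ _).1 ((dist_rot _ _ _).1 (ts_dist q))) fg.
have [_ /ge0P Q0] := ts_quo q.
by rewrite (Q0 Z Z0 e) cmpm0.
Qed.

(** A nonzero map [g : S -> F] to the quotient [F] has a nonzero torsion image:
  if [F'] is the cokernel, obtained by truncating the cone of [g], then the fiber
  [J] of [F -> F'] is an extension of an object of negative degree by [S].  The
  preimage of [J] in [H], the fiber of [H -> F -> F'], is the larger torsion
  subobject. *)
Lemma tors_subobject_enlarge H (H_ge0 : ge0 tau H) (q : tors_subobject H) S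
  (g : mor S (tquo q)) : tors S -> g <> 0 ->
  exists q' : tors_subobject H,
    (exists u : mor (tsub q) (tsub q'), tin q' \c u = tin q) /\
    ~ (exists u : mor (tsub q') (tsub q), tin q \c u = tin q').
Proof.
move=> tS g_neq0; have [F0 /ge0P F_ge0] := ts_quo q.
have [[S0 _] [T0 _]] := (tS, ts_sub q).
have [K [c [c' dK]]] := dist_cone g.
have [L [F' [l [t [t' [L0 F'0 dF']]]]]] := trunc_ge0 K.
have K0 := le0_cone dK S0 F0.
have [J [j [j' dJ]]] := exists_fiber (t \c c).
have [p [p' [p'' [dp jp _]]]] := dist_oct_fiber dK dF' dJ.
have tJ : tors J by apply: tors_ext dp tS (tors_Sh L0).
have [T' [m [m' dT']]] := exists_fiber ((t \c c) \c tpr q).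
have [r [r' [r'' [dr mr jr]]]] := dist_oct_fiber (ts_dist q) dJ dT'.
have tT' : tors T' by apply: tors_ext dr (ts_tors q) tJ.
have hT' : heart tau T' by split; [exact: tT'.1 | exact: ge0_fiber dT' H_ge0 F'0].
have hF' : heart tau F' by split=> //; apply: le0_cone dF' (le0_Sh L0) K0.
exists (TorsSubobject dT' hT' hF' tT') => /=; split; first by exists r.
(* If the new subobject lay in the old one, its image J in F would vanish. *)
move=> [u mu]; apply: g_neq0.
have [|e je] := dist_factor (e := j) dr.
  by rewrite jr -mu cmpA (dist_cmp0 (ts_dist q)) cmp0m.
by rewrite -jp je (F_ge0 _ T0 e) !cmp0m.
Qed.

Hypothesis tau_noeth : noetherian tau.

Lemma exists_torsion_radical H : heart tau H ->
  exists q : tors_subobject H, forall S, tors S -> hom0 S (tquo q).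
Proof.
move=> hH; apply: NNPP => no_max.
have enlarge (q : tors_subobject H) : exists q' : tors_subobject H,
    (exists u : mor (tsub q) (tsub q'), tin q' \c u = tin q) /\
    ~ (exists u : mor (tsub q') (tsub q), tin q \c u = tin q').
  apply: NNPP => no_q'; apply: no_max; exists q => S tS g; apply: NNPP => g0.
  by apply: no_q'; apply: tors_subobject_enlarge tS g0; case: hH.
pose next q := proj1_sig (constructive_indefinite_description _ (enlarge q)).
have nextP q : _ := proj2_sig (constructive_indefinite_description _ (enlarge q)).
have [O O0] := lin_cat_zero D.
have tO : tors O.
  by split=> [|i]; [apply/le0P => Y _|]; apply: hom0_zerol.
have hO : heart tau O.
  by split; [exact: tO.1 | apply/ge0P => Y _; apply: hom0_zeror].
pose q0 := TorsSubobject (dist_id_src H O0) hO hH tO.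
have [N stable] := tau_noeth hH (A := fun i => tsub (iter i next q0))
  (m := fun i => tin (iter i next q0)) (fun i => ts_sub _) (fun i => @tin_mono _ _)
  (fun i => (nextP (iter i next q0)).1).
exact: (nextP (iter N next q0)).2 (stable N.+1 (leqnSn N)).
Qed.

(** Coreflection into the aisle of the t-structure tilted at [tors]: pull the
  radical of the degree-0 cohomology of [A] back to [A]. *)
Lemma tilt_coreflection A : le0 tau A ->
  exists (B : D) (b : mor B A), tors B /\ colocal tors b.
Proof.
move=> A0; have [L [H [l [p [h [L0 H0 dH]]]]]] := trunc_ge0 A.
have hH : heart tau H by split=> //; apply: le0_cone dH (le0_Sh L0) A0.
have [q qP] := exists_torsion_radical hH.
have [B [b [b' dB]]] := exists_fiber (tpr q \c p).
have [r [r' [r'' [dr _ _]]]] := dist_oct_fiber dH (ts_dist q) dB.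
exists B, b; split; first exact: tors_ext dr (tors_Sh L0) (ts_tors q).
by exists (tquo q), (tpr q \c p), b'.
Qed.

End TStructureTheory.

(** * Killing the maps to an exceptional object *)

Section Mutation.
Variables (k : fieldType) (D : tri_cat k).
Implicit Types X Y Z W A : D.

Lemma hom0_iter_Sh i X Y (m : int) :
  hom0 X (sh (m - i%:Z) Y) -> hom0 (iter i Sh X) (sh m Y).
Proof.
elim: i m => [|i IH] m /= XY0; first by rewrite subr0 in XY0.
rewrite -(subrK 1 m); apply: (hom0_isor (isomorphic_sym (shS (m - 1) Y))).
apply/(hom0_Sh _ _).1/IH; move: XY0.
by rewrite -addn1 PoszD opprD addrA addrAC.
Qed.

Lemma rhom_zero_iter_Sh i X Y : rhom_zero X Y -> rhom_zero (iter i Sh X) Y.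
Proof. by move=> XY0 m; apply: hom0_iter_Sh; apply: XY0. Qed.

Lemma rhom_zero_hom0 X Y : rhom_zero X Y -> hom0 X Y.
Proof. exact: (fun XY0 => XY0 0). Qed.

Lemma rhom_zero_mid_src X Y Z W (f : mor X Y) (g : mor Y Z) (h : mor Z (Sh X)) :
  dist f g h -> rhom_zero X W -> rhom_zero Z W -> rhom_zero Y W.
Proof.
by move=> fgh XW ZW n; apply: (hom0_mid_src fgh) => e; [apply: XW | apply: ZW].
Qed.

Lemma endo_iter_Sh (X : D) : (forall f : mor X X, exists c : k, f = c *: idm X) ->
  forall i (f : mor (iter i Sh X) (iter i Sh X)), exists c : k, f = c *: idm _.
Proof.
move=> X1; elim=> [|i IH] f; first exact: X1.
have [g <-] := Sh_full f; have [c ->] := IH g.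
by exists c; rewrite fmapZ fmap1.
Qed.

Lemma rhom_single X Y m (f : mor X (sh m Y)) : exists F : rhom_family X Y,
  F m = f /\ forall n : int, n != m -> F n = 0.
Proof.
exists (fun n => match m =P n with
  | ReflectT e => eq_rect m (fun n => mor X (sh n Y)) f n e
  | ReflectF _ => 0 end); split=> [|n /eqP nm].
  by case: eqP => // e; rewrite (eq_irrelevance e (erefl m)).
by case: eqP => // e; case: nm.
Qed.

Definition rhom_spanned d X Y : Prop := exists v : 'I_d -> rhom_family X Y,
  forall f : rhom_family X Y, fin_supp f ->
  exists c : 'I_d -> k, forall n : int, f n = \sum_(i < d) c i *: v i n.

Lemma rhom_spanned0 X Y : rhom_spanned 0 X Y -> rhom_zero X Y.
Proof.
move=> [v span] n f; have [F [Fn Fn0]] := rhom_single f.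
have [|c /(_ n)] := span F; last by rewrite Fn big_ord0.
by exists [:: n] => m; rewrite inE => /Fn0.
Qed.

(** A nonzero element killed by precomposition with [a] is a linear relation
  between the images of the generators, so one of these is redundant. *)
Lemma rhom_spanned_drop d X X' Y (a : mor X' X) m (f : mor X (sh m Y)) :
  f <> 0 -> f \c a = 0 ->
  (forall n (e : mor X' (sh n Y)), exists e' : mor X (sh n Y), e = e' \c a) ->
  rhom_spanned d.+1 X Y -> rhom_spanned d X' Y.
Proof.
move=> f_neq0 fa0 lift_a [v span]; have [F [Fm Fn0]] := rhom_single f.
have [|c Fc] := span F; first by exists [:: m] => n; rewrite inE => /Fn0.
have [i ci] : exists i, c i != 0.
  apply: NNPP => c0; apply: f_neq0; rewrite -Fm Fc big1 // => i _.
  by case: (eqVneq (c i) 0) => [->|ci]; [rewrite scale0r | case: c0; exists i].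
have Fa0 n : F n \c a = 0.
  case: (eqVneq n m) => [->|/Fn0 ->]; last exact: cmp0m.
  by rewrite Fm.
exists (fun j n => v (lift i j) n \c a) => e [s es].
have lift_e n : exists e' : mor X (sh n Y), e n = e' \c a /\ (e n = 0 -> e' = 0).
  case: (classic (e n = 0)) => [en0|en0].
    by exists 0; rewrite en0 cmp0m.
  by have [e' ee'] := lift_a n (e n); exists e'.
pose e' n := proj1_sig (constructive_indefinite_description _ (lift_e n)).
have e'P n : e n = e' n \c a /\ (e n = 0 -> e' n = 0).
  exact: proj2_sig (constructive_indefinite_description _ (lift_e n)).
have [|b e'b] := span e'; first by exists s => n /es /(e'P n).2.
(* Subtracting the multiple of the relation [F] that cancels the [i]-th term. *)
exists (fun j => b (lift i j) - b i / c i * c (lift i j)) => n.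
have -> : e n = (e' n - (b i / c i) *: F n) \c a.
  by rewrite cmpBm cmpZm Fa0 scaler0 subr0; exact: (e'P n).1.
rewrite e'b Fc scaler_sumr -sumrB cmp_suml (bigD1_ord i) //=.
rewrite scalerA divfK // subrr cmp0m add0r.
by apply: eq_bigr => j _; rewrite scalerA -scalerBl cmpZm.
Qed.

Variable E : D.
Hypothesis E_exc : exceptional E.

(** A map [Y -> E[m]] restricts to a multiple of the identity on the fiber
  [E[i]] if [m = i] and to zero otherwise; a nonzero multiple would split off
  [E[i]], forcing [f = 0]. *)
Lemma extend_along_fiber i Y Z (w : mor (iter i Sh E) Y) (a : mor Y Z)
  (f : mor Z (Sh (iter i Sh E))) : dist w a f -> f <> 0 ->
  forall m (e : mor Y (sh m E)), exists e' : mor Z (sh m E), e = e' \c a.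
Proof.
have [_ [c1 _ c1K] E0] := E_exc.
move=> waf f_neq0 m e; apply: (dist_extend waf).
case: (eqVneq m i%:Z) => [mi|mi]; last first.
  by apply: hom0_iter_Sh => g; apply: E0; rewrite subr_eq0.
subst m; have [|c ewc] := endo_iter_Sh _ (e \c w).
  by move=> g; exists (c1 g); rewrite c1K.
case: (eqVneq c 0) => [c0|c_neq0]; first by rewrite ewc c0 scale0r.
case: f_neq0; rewrite -(cmp1m f) -fmap1.
have -> : idm (iter i Sh E) = (c^-1 *: e) \c w.
  by rewrite cmpZm ewc scalerA mulVf // scale1r.
have := dist_cmp0 ((dist_rot _ _ _).1 ((dist_rot _ _ _).1 waf)).
rewrite cmpNm => /eqP; rewrite oppr_eq0 => /eqP wf0.
by rewrite fmapM -cmpA wf0 cmpm0.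
Qed.

(** Replacing [A] by the fiber of a nonzero [f : A -> E[i+1]], an extension of [A]
  by [E[i]], lowers the dimension of [RHom(A, E)] by one.  What remains in the end
  is the right mutation of [A] through [E], up to shift. *)
Lemma kill_rhom (P : D -> Prop) :
  (forall i Y Z (w : mor (iter i Sh E) Y) (a : mor Y Z) f,
    dist w a f -> P Z -> P Y) ->
  forall A, P A -> (forall n : int, n <= 0 -> hom0 A (sh n E)) -> rhom_findim A E ->
  exists (B : D) (b : mor B A),
    [/\ P B, rhom_zero B E & colocal (fun S => rhom_zero S E) b].
Proof.
move=> P_ext A PA A_neg [d [v [_ v_span]]].
have {v v_span} : rhom_spanned d A E by exists v.
elim: d A PA A_neg => [|d IH] A PA A_neg A_span.
  by exists A, (idm A); split=> //; [apply: rhom_spanned0 | apply: colocal_id].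
case: (classic (rhom_zero A E)) => [AE|AE].
  by exists A, (idm A); split=> //; apply: colocal_id.
have [i [f f_neq0]] : exists i (f : mor A (Sh (iter i Sh E))), f <> 0.
  apply: NNPP => no_f; apply: AE => -[[|i]|i] f.
  - exact: A_neg.
  - by apply: NNPP => f_neq0; apply: no_f; exists i, f.
  - exact: A_neg.
have [B [w [a waf]]] := exists_mid f.
have lift_a := extend_along_fiber waf f_neq0.
have fa0 := dist_cmp0 ((dist_rot _ _ _).1 waf).
have [|||C [c [PC CE c_coloc]]] := IH B.
- exact: P_ext waf PA.
- by move=> n n0 e; have [e' ->] := lift_a n e; rewrite (A_neg n n0 e') cmp0m.
- exact: (rhom_spanned_drop (m := i.+1%:Z)) f_neq0 fa0 lift_a A_span.
exists C, (a \c c); split=> //; apply: colocal_comp c_coloc _.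
exists (Sh (iter i Sh E)), f, (- fmap Sh w); split; first exact: (dist_rot _ _ _).1 waf.
by move=> S SE; apply: (SE i.+1%:Z).
Qed.

End Mutation.

(** * The induced t-structure on the left orthogonal *)

Section Orthogonal.
Variables (k : fieldType) (D : tri_cat k) (tau : t_pair D).
Hypothesis tau_t : is_tstructure tau.
Variables (n : nat) (E : 'I_n -> D).
Hypothesis E_heart : forall i, heart tau (E i).
Hypothesis E_exc : exceptional_seq E.
Hypothesis E_hom0 : forall i j : 'I_n, (i < j)%N -> hom0 (E i) (E j).

Lemma seq_ge0 i : ge0 tau (E i).
Proof. by case: (E_heart i). Qed.

(** Killing the maps to [E_m] extends the object by shifts [E_m[i]] with [i >= 0].
  For [j] other than [m] these have no maps to [E_j], by semiorthogonality one way
  and by [E_hom0] the other, while maps to [E_m] itself are gone in the end.  The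
  induction starts from [E_0] because [RHom(E_m, E_j) = 0] for [j < m]: this is
  what preserves orthogonality to the earlier objects. *)
Lemma tors_coreflection_upto m A : (m <= n)%N -> tors tau E A ->
  exists (B : D) (b : mor B A),
    [/\ tors tau E B, forall j : 'I_n, (j < m)%N -> rhom_zero B (E j)
      & colocal (left_orth E) b].
Proof.
have [exc semiorth] := E_exc.
elim: m => [_ tA|m IH mn tA].
  by exists A, (idm A); split=> //; apply: colocal_id.
have [B [b [[B0 BE] B_orth b_coloc]]] := IH (ltnW mn) tA.
pose j0 := Ordinal mn.
pose P Y := [/\ le0 tau Y, forall j, j != j0 -> hom0 Y (E j)
  & forall j : 'I_n, (j < m)%N -> rhom_zero Y (E j)].
have P_ext i Y Z (w : mor (iter i Sh (E j0)) Y) (a : mor Y Z) f :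
    dist w a f -> P Z -> P Y.
  move=> waf [Z0 ZE Z_orth]; split.
  - apply: (le0_ext tau_t waf) => //.
    by apply: (le0_iter_Sh tau_t); case: (E_heart j0).
  - move=> j jj0; apply: (hom0_mid_src waf); last exact: ZE.
    case: i {w f waf} => [|i] /=; last first.
      have /(ge0P tau_t) := seq_ge0 j; apply.
      by apply: (le0_iter_Sh tau_t); case: (E_heart j0).
    case: (ltngtP j j0) => [lt_j|gt_j|eq_j].
    + exact/rhom_zero_hom0/semiorth.
    + exact: E_hom0.
    + by case/eqP: jj0; apply: val_inj.
  - move=> j jm; apply: (rhom_zero_mid_src waf); last exact: Z_orth.
    exact/rhom_zero_iter_Sh/semiorth.
have B_neg (l : int) : l <= 0 -> hom0 B (sh l (E j0)).
  case: l => [[|l]|l] // _; first exact: BE.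
  apply: (gt0P tau_t _).1 B0; exists (iter l Shi (E j0)).
    by apply: (ge0_iter_Shi tau_t); apply: seq_ge0.
  exact: isomorphic_refl.
have [findim _ _] := exc j0.
have [|C [c [[C0 CE C_orth] CEj c_coloc]]] :=
    kill_rhom (exc j0) P_ext (A := B) _ B_neg (findim B).2.
  by split.
have C_orth_j0 j : j = j0 -> rhom_zero C (E j) by move=> ->.
exists C, (b \c c); split.
- split=> // j; case: (eqVneq j j0) => [/C_orth_j0/rhom_zero_hom0|/CE] //.
- move=> j; rewrite ltnS leq_eqVlt => /predU1P[jm|]; last exact: C_orth.
  exact/C_orth_j0/val_inj.
- by apply: colocal_comp b_coloc; apply: colocal_sub c_coloc => S; apply.
Qed.

Lemma tors_coreflection A : tors tau E A ->
  exists (B : D) (b : mor B A),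
    [/\ le0 tau B, left_orth E B & colocal (left_orth E) b].
Proof.
move=> tA; have [B [b [[B0 _] B_orth b_coloc]]] := tors_coreflection_upto (leqnn n) tA.
by exists B, b; split=> // i; apply: B_orth.
Qed.

Hypothesis tau_noeth : noetherian tau.

Lemma orth_coreflection (X : D) : exists (A : D) (a : mor A X),
  [/\ le0 tau A, left_orth E A
    & colocal (fun S => le0 tau S /\ left_orth E S) a].
Proof.
have [_ _ _ _ trunc] := tau_t.
have [A [Z [f [g [h [A0 Z1 fgh]]]]]] := trunc X.
have [B [b [tB b_coloc]]] := tilt_coreflection tau_t seq_ge0 tau_noeth A0.
have [C [c [C0 CC c_coloc]]] := tors_coreflection tB.
exists C, (f \c (b \c c)); split=> //; apply: colocal_comp; last first.
  by exists Z, g, h; split=> // S [S0 _]; apply: (gt0P tau_t Z).1 S0.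
apply: colocal_comp; first by apply: colocal_sub c_coloc => S [].
by apply: colocal_sub b_coloc => S [S0 SE]; split=> // i; apply/rhom_zero_hom0/SE.
Qed.

Lemma sub_isomorphicP (C : tri_sub D) (X Y : C) :
  isomorphic X Y <-> isomorphic (sval X) (sval Y).
Proof. by []. Qed.

Lemma sval_sh (C : tri_sub D) m (X : C) : sval (sh m X) = sh m (sval X).
Proof.
have iter_Sh i : sval (iter i (@Sh k C) X) = iter i Sh (sval X).
  by elim: i => //= i ->.
have iter_Shi i : sval (iter i (@Shi k C) X) = iter i Shi (sval X).
  by elim: i => //= i ->.
by case: m => i /=; rewrite ?iter_Sh ?iter_Shi.
Qed.

Lemma ge0_connP (C : tri_sub D) (X : C) :
  ge0 (conn_pair tau C) X <->
  forall S : C, le0 tau (sval S) -> hom0 (Sh S) X.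
Proof. by []. Qed.

Lemma conn_pair_tstructure : is_tstructure (conn_pair tau (left_orth E)).
Proof.
have [[le_iso _] _ _ _ _] := tau_t.
split.
- split=> X Y XY X0; first exact: (le_iso (sval X) (sval Y) XY X0).
  by apply/ge0_connP => S S0; apply: (hom0_isor XY); apply: X0.
- move=> X X0; exists (Sh X); first exact: (le0_Sh tau_t).
  exact/isomorphic_sym/isomorphic_ShiSh.
- move=> X [Y /ge0_connP Y0 XY]; apply/ge0_connP => S S0.
  apply: (hom0_isor (isomorphic_sym XY)); apply: (hom0_ShShi _ Y).1.
  by apply: (Y0 (Sh S)); apply: (le0_Sh tau_t).
- move=> X Y X0 [Z /ge0_connP Z0 YZ]; change (hom0 X Y).
  by apply: (hom0_isor (isomorphic_sym YZ)); apply: (hom0_ShShi X Z).1; apply: Z0.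
- move=> [X CX]; have [A [a [A0 CA [B [g [h [agh QB]]]]]]] := orth_coreflection X.
  have CB := tmem_cone agh CA CX.
  exists (exist _ A CA), (exist _ B CB), a, g, h; split=> //.
  exists (Sh (exist _ B CB : left_orth E)); last exact/isomorphic_sym/isomorphic_ShiSh.
  apply/ge0_connP => -[S CS] S0; apply: (hom0_Sh S B).1.
  exact: QB.
Qed.

Lemma conn_pair_bounded : bounded tau -> bounded (conn_pair tau (left_orth E)).
Proof.
have [[le_iso ge_iso] _ _ _ _] := tau_t.
move=> tau_b X; have [a [b [[Y Y0 XY] [Z Z0 XZ]]]] := tau_b (sval X).
have sh_iso m V : isomorphic (sval X) (sh (- m) V) ->
    isomorphic (sval (sh m X)) V.
  move=> XV; rewrite sval_sh.
  exact: isomorphic_trans (isomorphic_sh m XV) (isomorphic_shNK _ _).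
exists a, b; split.
  exists (sh a X); last first.
    by apply/sub_isomorphicP; rewrite !sval_sh; apply/isomorphic_sym/isomorphic_shK.
  apply/ge0_connP => S S0.
  apply: (hom0_isor (isomorphic_sym (sh_iso a Y XY)) : _ -> hom0 (Sh (sval S)) _).
  by apply: (ge0P tau_t Y).1.
exists (sh b X); last first.
  by apply/sub_isomorphicP; rewrite !sval_sh; apply/isomorphic_sym/isomorphic_shK.
exact: le_iso (isomorphic_sym (sh_iso b Z XZ)) Z0.
Qed.

End Orthogonal.

Theorem theorem1p7 (k : fieldType) (D : tri_cat k) (tau : t_pair D)
  (tau_t : is_tstructure tau) (tau_noeth : noetherian tau)
  (n : nat) (E : 'I_n -> D)
  (E_heart : forall i : 'I_n, heart tau (E i))
  (E_exc : exceptional_seq E)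
  (E_hom0 : forall i j : 'I_n, (i < j)%N -> forall f : mor (E i) (E j), f = 0%R) :
  connectively_induces tau (left_orth E) /\
  (bounded tau -> bounded (conn_pair tau (left_orth E))).
Proof.
split; first exact: conn_pair_tstructure.
exact: conn_pair_bounded.
Qed.
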